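(* Let $\mathbb{T}$ be a time scale and let $f:\mathbb{T}\to\mathbb{R}$ be delta and nabla differentiable. Suppose that the function $$\gamma(t)=\lim_{s\to t}\frac{\sigma(t)-s}{\sigma(t)+2t-2s-\rho(t)},\qquad t\in\mathbb{T}_{\kappa}^{\kappa},$$ is constant, $\gamma(t)\equiv\alpha$. Then the symmetric derivative of $f$ coincides with the diamond-$\alpha$ derivative of $f$: for each $t\in\mathbb{T}_{\kappa}^{\kappa}$, $$f^{\diamondsuit}(t)=\alpha f^{\Delta}(t)+(1-\alpha)f^{\nabla}(t).$$
   Context: A time scale $\mathbb{T}$ is a nonempty closed subset of $\mathbb{R}$, with the topology inherited from the standard topology of $\mathbb{R}$. The forward jump operator $\sigma:\mathbb{T}\to\mathbb{T}$ is $\sigma(t):=\inf\{s\in\mathbb{T}:s>t\}$ with the convention $\inf\emptyset=\sup\mathbb{T}$ (so $\sigma(M)=M$ if $\mathbb{T}$ has a maximum $M$); the backward jump operator $\rho:\mathbb{T}\to\mathbb{T}$ is $\rho(t):=\sup\{s\in\mathbb{T}:s<t\}$ with $\sup\emptyset=\inf\mathbb{T}$ (so $\rho(m)=m$ if $\mathbb{T}$ has a minimum $m$). A point $t\in\mathbb{T}$ is right-scattered if $\sigma(t)>t$ and left-scattered if $\rho(t)<t$. If $\sup\mathbb{T}$ is finite and left-scattered, $\mathbb{T}^{\kappa}:=\mathbb{T}\setminus\{\sup\mathbb{T}\}$, otherwise $\mathbb{T}^{\kappa}:=\mathbb{T}$; if $\inf\mathbb{T}$ is finite and right-scattered, $\mathbb{T}_{\kappa}:=\mathbb{T}\setminus\{\inf\mathbb{T}\}$,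 otherwise $\mathbb{T}_{\kappa}:=\mathbb{T}$; $\mathbb{T}_{\kappa}^{\kappa}:=\mathbb{T}_{\kappa}\cap\mathbb{T}^{\kappa}$. Write $f^{\sigma}:=f\circ\sigma$ and $f^{\rho}:=f\circ\rho$. Symmetric derivative: for $f:\mathbb{T}\to\mathbb{R}$ and $t\in\mathbb{T}_{\kappa}^{\kappa}$, the symmetric derivative of $f$ at $t$, denoted $f^{\diamondsuit}(t)$, is the real number (provided it exists) such that for every $\varepsilon>0$ there is a neighborhood $U\subset\mathbb{T}$ of $t$ with $$\left|\left[f^{\sigma}(t)-f(s)+f(2t-s)-f^{\rho}(t)\right]-f^{\diamondsuit}(t)\left[\sigma(t)+2t-2s-\rho(t)\right]\right|\leqslant\varepsilon\left|\sigma(t)+2t-2s-\rho(t)\right|$$ for all $s\in U$ for which $2t-s\in U$. Delta and nabla derivatives (standard in time scale calculus): $f$ is delta differentiable if for every $t\in\mathbb{T}^{\kappa}$ there is a real number $f^{\Delta}(t)$ such that for every $\varepsilon>0$ there is a neighborhood $U\subset\mathbb{T}$ of $t$ with $|f^{\sigma}(t)-f(s)-f^{\Delta}(t)(\sigma(t)-s)|\leqslant\varepsilon|\sigma(t)-s|$ for all $s\in U$; $f$ is nabla differentiable if for every $t\in\mathbb{T}_{\kappa}$ there is a real number $f^{\nabla}(t)$ such that for every $\varepsilon>0$ there is a neighborhood $U\subset\mathbb{T}$ of $t$ with $|f^{\rho}(t)-f(s)-f^{\nabla}(t)(\rho(t)-s)|\leqslant\varepsilon|\rho(t)-s|$ for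 all $s\in U$. For such $f$, the diamond-$\alpha$ derivative at $t\in\mathbb{T}_{\kappa}^{\kappa}$ is $\alpha f^{\Delta}(t)+(1-\alpha)f^{\nabla}(t)$. In the limit defining $\gamma(t)$, $s$ ranges over the points of $\mathbb{T}$ at which the quotient is defined; $s=t$ is allowed when $\sigma(t)\neq\rho(t)$ (so at an isolated point $t$ the limit is the value of the quotient at $s=t$). *)

(* Defs.v *)
From HB Require Import structures.
From mathcomp Require Import all_boot all_order all_algebra.
From mathcomp Require Import all_classical all_reals all_analysis.
Set Implicit Arguments.
Unset Strict Implicit.
Unset Printing Implicit Defensive.
Import Order.TTheory GRing.Theory Num.Theory.
Import numFieldNormedType.Exports.
Local Open Scope classical_set_scope.
Local Open Scope ring_scope.

(* A function on a time scale T is represented by a function R -> R; the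
   notions below only look at its values on T, as the jump operators map T
   into T (T is closed). *)

Definition time_scale (R : realType) (T : set R) : Prop :=
  T !=set0 /\ closed T.

Definition fwd_jump (R : realType) (T : set R) (t : R) : R :=
  if `[< [set s | T s /\ t < s] !=set0 >] then inf [set s | T s /\ t < s]
  else sup T.

Definition bwd_jump (R : realType) (T : set R) (t : R) : R :=
  if `[< [set s | T s /\ s < t] !=set0 >] then sup [set s | T s /\ s < t]
  else inf T.

Definition right_scattered (R : realType) (T : set R) (t : R) : Prop :=
  t < fwd_jump T t.

Definition left_scattered (R : realType) (T : set R) (t : R) : Prop :=
  bwd_jump T t < t.

(* T^kappa *)
Definition upper_kappa (R : realType) (T : set R) : set R :=
  if `[< has_ubound T /\ left_scattered T (sup T) >] then T `\ sup T else T.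

(* T_kappa *)
Definition lower_kappa (R : realType) (T : set R) : set R :=
  if `[< has_lbound T /\ right_scattered T (inf T) >] then T `\ inf T else T.

(* T_kappa^kappa *)
Definition both_kappa (R : realType) (T : set R) : set R :=
  lower_kappa T `&` upper_kappa T.

(* U is a neighborhood of t (t in T) for the topology induced on T *)
Definition ts_nbhs (R : realType) (T : set R) (t : R) (U : set R) : Prop :=
  U `<=` T /\ within T (nbhs t) U.

Definition is_delta_deriv (R : realType) (T : set R) (f : R -> R) (t l : R) :
    Prop :=
  forall eps : R, 0 < eps -> exists2 U : set R, ts_nbhs T t U &
    forall s, U s ->
      `|f (fwd_jump T t) - f s - l * (fwd_jump T t - s)|
        <= eps * `|fwd_jump T t - s|.

Definition is_nabla_deriv (R : realType) (T : set R) (f : R -> R) (t l : R) :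
    Prop :=
  forall eps : R, 0 < eps -> exists2 U : set R, ts_nbhs T t U &
    forall s, U s ->
      `|f (bwd_jump T t) - f s - l * (bwd_jump T t - s)|
        <= eps * `|bwd_jump T t - s|.

Definition delta_differentiable_with (R : realType) (T : set R)
    (f fD : R -> R) : Prop :=
  forall t, upper_kappa T t -> is_delta_deriv T f t (fD t).

Definition nabla_differentiable_with (R : realType) (T : set R)
    (f fN : R -> R) : Prop :=
  forall t, lower_kappa T t -> is_nabla_deriv T f t (fN t).

Definition diamond_alpha_deriv (R : realType) (alpha : R) (fD fN : R -> R)
    (t : R) : R :=
  alpha * fD t + (1 - alpha) * fN t.

Definition symm_step (R : realType) (T : set R) (t s : R) : R :=
  fwd_jump T t + 2 * t - 2 * s - bwd_jump T t.

(* A relation rather than a function: when sigma(t) = rho(t) = t and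
   no s <> t near t has both s and 2 t - s in T, the condition holds for every
   l, so f^diamondsuit(t) = l can only be read as "l is a symmetric derivative
   of f at t". *)
Definition is_symm_deriv (R : realType) (T : set R) (f : R -> R) (t l : R) :
    Prop :=
  forall eps : R, 0 < eps -> exists2 U : set R, ts_nbhs T t U &
    forall s, U s -> U (2 * t - s) ->
      `|(f (fwd_jump T t) - f s + f (2 * t - s) - f (bwd_jump T t))
          - l * symm_step T t s|
        <= eps * `|symm_step T t s|.

(* gamma(t) exists and equals l.  The limit is taken over the s in T at which
   the quotient is defined; s = t is not excluded a priori, so it counts
   exactly when sigma(t) <> rho(t). *)
Definition gamma_is (R : realType) (T : set R) (t l : R) : Prop :=
  (fwd_jump T t - s) / symm_step T t s
    @[s --> within [set s | T s /\ symm_step T t s != 0] (nbhs t)] --> l.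

(* Main.v *)
Require Import Defs.
From mathcomp Require Import all_boot all_order all_algebra.
From mathcomp Require Import all_classical all_reals all_analysis.
From mathcomp Require Import ring lra.
Import Order.TTheory GRing.Theory Num.Theory.
Import numFieldNormedType.Exports.
Local Open Scope classical_set_scope.
Local Open Scope ring_scope.

(** Write [D s] for the symmetric step [sigma(t) + 2 t - 2 s - rho(t)] and [q s]
    for [(sigma(t) - s) / D s].  The step splits as
    [D s = (sigma(t) - s) + ((2 t - s) - rho(t))], so that, when [D s != 0], the
    two summands are [q s * D s] and [(1 - q s) * D s].  The delta derivative
    controls the increment of [f] over the first, the nabla derivative at the
    point [2 t - s] that over the second, with errors that are small multiples
    of [|q s| |D s|] and [|1 - q s| |D s|] respectively.  Since [q s] tends to
    [gamma(t) = alpha], these coefficients stay bounded, and replacing [q s] by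
    [alpha] in the main term costs only [|q s - alpha| |fD t - fN t| |D s|]
    ([symm_increment_bound]).  The points with [D s = 0] are harmless: near [t]
    the only possible one is [s = t], with [sigma(t) = rho(t)], where the
    symmetric increment of [f] vanishes ([near_symm_step_eq0]).  The argument is
    local, so it gives the formula at every [t] where both derivatives and
    [gamma(t)] exist ([is_symm_deriv_diamond]). *)

(** [x] and [y] are the increments of [f] over the two parts [q * D] and
    [(1 - q) * D] of the symmetric step [D]. *)
Lemma symm_increment_bound (R : realType) (x y d n q alpha D e delta : R) :
  0 <= e -> delta <= 1 -> `|q - alpha| <= delta ->
  `|x - d * (q * D)| <= e * `|q * D| ->
  `|y - n * ((1 - q) * D)| <= e * `|(1 - q) * D| ->
  `|x + y - (alpha * d + (1 - alpha) * n) * D|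
    <= (e * (2 * `|alpha| + 3) + delta * `|d - n|) * `|D|.
Proof.
move=> e0 delta1 qa hx hy.
have -> : x + y - (alpha * d + (1 - alpha) * n) * D =
    (x - d * (q * D)) + (y - n * ((1 - q) * D)) + (q - alpha) * (d - n) * D.
  by ring.
have hq : `|q| <= `|alpha| + 1.
  have -> : q = alpha + (q - alpha) by ring.
  by apply: le_trans (ler_normD _ _) _; lra.
have hq1 : `|1 - q| <= `|alpha| + 2.
  by apply: le_trans (ler_normB _ _) _; rewrite normr1; lra.
have hdn : `|(q - alpha) * (d - n) * D| <= delta * `|d - n| * `|D|.
  by rewrite !normrM !ler_wpM2r.
apply: le_trans (ler_normD _ _) _.
rewrite [leRHS]mulrDl; apply: lerD => //.
apply: le_trans (ler_normD _ _) _.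
apply: le_trans (lerD hx hy) _.
rewrite !normrM -mulrDr -mulrDl -mulrA ler_wpM2l// ler_wpM2r//; lra.
Qed.

Lemma near_symm_step_eq0 (R : realType) (T : set R) (t : R) :
  \forall s \near t, symm_step T t s = 0 ->
    s = t /\ fwd_jump T t = bwd_jump T t.
Proof.
have [ab|ab] := eqVneq (fwd_jump T t) (bwd_jump T t).
  by near=> s; rewrite /symm_step => D0; split => //; lra.
have r0 : 0 < `|fwd_jump T t - bwd_jump T t| / 2.
  by rewrite divr_gt0// normr_gt0 subr_eq0.
(* A zero of the step lies at distance |sigma(t) - rho(t)| / 2 from t. *)
near=> s; rewrite /symm_step => D0.
have : `|t - s| < `|fwd_jump T t - bwd_jump T t| / 2.
  by near: s; exact: nbhsx_ballx.
have -> : fwd_jump T t - bwd_jump T t = - (t - s) * 2 by lra.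
by rewrite normrM normrN [`|2|]ger0_norm// mulfK// ltxx.
Unshelve. all: by end_near. Qed.

Lemma is_symm_deriv_diamond (R : realType) (T : set R) (f : R -> R)
    (t d n alpha : R) :
  is_delta_deriv T f t d -> is_nabla_deriv T f t n -> gamma_is T t alpha ->
  is_symm_deriv T f t (alpha * d + (1 - alpha) * n).
Proof.
move=> hd hn hg eps eps0.
(* The two terms of symm_increment_bound each get half of eps. *)
pose e := eps / 2 / (2 * `|alpha| + 3).
pose delta := Num.min 1 (eps / 2 / (`|d - n| + 1)).
have c0 : 0 < 2 * `|alpha| + 3 by have := normr_ge0 alpha; lra.
have k0 : 0 < `|d - n| + 1 by have := normr_ge0 (d - n); lra.
have e0 : 0 < e by rewrite !divr_gt0.
have delta0 : 0 < delta by rewrite lt_min ltr01 !divr_gt0.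
have [U1 [_ U1t] hU1] := hd e e0.
have [U2 [_ U2t] hU2] := hn e e0.
have gt : \forall s \near t, T s /\ symm_step T t s != 0 ->
    `|(fwd_jump T t - s) / symm_step T t s - alpha| < delta.
  by move/cvgr_distC_lt : hg => /(_ _ delta0).
pose V := [set s | T s /\ symm_step T t s != 0 ->
    `|(fwd_jump T t - s) / symm_step T t s - alpha| < delta].
pose W := [set s | symm_step T t s = 0 ->
    s = t /\ fwd_jump T t = bwd_jump T t].
exists (T `&` (U1 `&` U2) `&` (V `&` W)).
  split; first by move=> s [[]].
  have Wt : nbhs t W := near_symm_step_eq0 R T t.
  rewrite /within /= in U1t U2t *.
  apply: filterS (filterI (filterI U1t U2t) (filterI gt Wt)).
  move=> s [[s1 s2] [s3 s4]] Ts.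
  by split; split => //; split; [exact: s1|exact: s2].
move=> s [[Ts [U1s _]] [Vs Ws]] [[_ [_ U2s]] _].
have [D0|D0] := eqVneq (symm_step T t s) 0.
  rewrite D0; have [-> ->] := Ws D0.
  have -> : 2 * t - t = t by ring.
  by rewrite normr0 !mulr0 subr0 subrK subrr normr0.
pose D := symm_step T t s.
pose q := (fwd_jump T t - s) / D.
have qD : fwd_jump T t - s = q * D by rewrite divfK.
have q'D : 2 * t - s - bwd_jump T t = (1 - q) * D.
  by rewrite mulrBl -qD /D /symm_step; ring.
have hx := hU1 s U1s; rewrite qD in hx.
have hy := hU2 _ U2s.
have bD : bwd_jump T t - (2 * t - s) = - ((1 - q) * D) by rewrite -q'D; ring.
rewrite bD normrN -[X in X <= _]normrN mulrN opprK opprD opprB in hy.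
have qa : `|q - alpha| <= delta by apply/ltW/Vs.
have delta1 : delta <= 1 by rewrite ge_min lexx.
have := symm_increment_bound _ _ _ _ _ _ _ _ _ _ (ltW e0) delta1 qa hx hy.
rewrite addrA => /le_trans; apply.
apply: ler_wpM2r => //.
have -> : e * (2 * `|alpha| + 3) = eps / 2 by rewrite divfK// gt_eqF.
have : delta * `|d - n| <= eps / 2.
  apply: (@le_trans _ _ (delta * (`|d - n| + 1))).
    by rewrite ler_wpM2l ?(ltW delta0)// lerDl.
  by rewrite -ler_pdivlMr// ge_min lexx orbT.
lra.
Qed.

Theorem corollary4p4 (R : realType) (T : set R) (f fD fN : R -> R) (alpha : R)
  (hT : time_scale T)
  (hD : delta_differentiable_with T f fD)
  (hN : nabla_differentiable_with T f fN)
  (hgamma : forall t, both_kappa T t -> gamma_is T t alpha) :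
  forall t, both_kappa T t ->
    is_symm_deriv T f t (diamond_alpha_deriv alpha fD fN t).
Proof.
move=> t bt; have [lt ut] := bt.
by apply: is_symm_deriv_diamond; [exact: hD|exact: hN|exact: hgamma].
Qed.
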